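(* Let $X$ be a countably compact, perfectly normal space. Then $(L_0(X),\tau_V^+)$ and $(MC(X),\tau_V^+)$ are first countable.
   Context: All topological spaces are assumed Hausdorff and non-empty. A set-valued map $F$ from $X$ to $\mathbb{R}$ is identified with its graph $F\subseteq X\times\mathbb{R}$, with $F(x)=\{y:(x,y)\in F\}$. $F$ is usc if for every $x\in X$ and every open $V\supseteq F(x)$ there is a neighborhood $U$ of $x$ with $F(x')\subseteq V$ for all $x'\in U$. $F$ is cusco if it is usc and $F(x)$ is non-empty, compact and convex for every $x\in X$; it is minimal cusco if it is cusco and every cusco map $G\subseteq F$ satisfies $G=F$. $L_0(X)$ is the set of cusco maps $F\subseteq X\times\mathbb{R}$ such that $F(x)$ is a singleton for every isolated point $x$ of $X$; $MC(X)$ is the set of minimal cusco maps $F\subseteq X\times\mathbb{R}$. The upper Vietoris topology $\tau_V^+$ on either set $\mathcal{S}$ has as base the sets $W^+=\{F\in\mathcal{S}:F\subseteq W\}$, $W$ open in $X\times\mathbb{R}$. *)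

(* Defs.v *)
From HB Require Import structures.
From mathcomp Require Import all_boot all_order all_algebra.
From mathcomp Require Import all_classical all_reals all_analysis.
From mathcomp Require Import borel_hierarchy.
Set Implicit Arguments.
Unset Strict Implicit.
Unset Printing Implicit Defensive.
Import Order.TTheory GRing.Theory Num.Theory.
Import numFieldNormedType.Exports.
Local Open Scope classical_set_scope.
Local Open Scope ring_scope.

(* The countable families are those indexed by an arbitrary set of natural
   numbers, so finite families are included. *)
Definition countably_compact (T : topologicalType) (A : set T) :=
  forall (D : set nat) (f : nat -> set T),
    (forall i, D i -> open (f i)) -> A `<=` cover D f ->
    finite_subset_cover D f A.

(* As with [normal_space], no separation axiom is included. *)
Definition perfectly_normal_space (T : topologicalType) :=
  normal_space T /\ forall A : set T, closed A -> Gdelta A.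

Definition first_countable (T : topologicalType) :=
  forall x : T, exists2 B : set (set T), countable B &
    B `<=` nbhs x /\ filter_from B id --> x.

Section UpperVietoris.
Context {T : topologicalType} (S : set (set T)).

Definition upper_vietoris : Type := S.

HB.instance Definition _ := Choice.on upper_vietoris.

Definition upper_set (W : set T) : set upper_vietoris :=
  [set F | set_val F `<=` W].

Let upper_set_cover : \bigcup_(W in open) upper_set W = setT.
Proof. by apply/seteqP; split=> // F _; exists setT => //; exact: openT. Qed.

Let upper_set_join (V W : set T) (F : upper_vietoris) :
  open V -> open W -> upper_set V F -> upper_set W F ->
  exists U, [/\ open U, upper_set U F &
    upper_set U `<=` upper_set V `&` upper_set W].
Proof.
move=> oV oW FV FW; exists (V `&` W); split; first exact: openI.
- by move=> t Ft; split; [exact: FV|exact: FW].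
- by move=> G GVW; split=> t /GVW[].
Qed.

HB.instance Definition _ :=
  isBaseTopological.Build upper_vietoris upper_set_cover upper_set_join.

End UpperVietoris.

(* A set-valued map from X to R is its graph F : set (X * R); its value at x
   is [xsection F x]. *)
Section Cusco.
Context {R : realType} {X : topologicalType}.
Implicit Types F G : set (X * R).

Definition usc F := forall (x : X) (V : set R), open V ->
  xsection F x `<=` V -> \forall x' \near x, xsection F x' `<=` V.

Definition cusco F := usc F /\ forall x : X,
  [/\ xsection F x !=set0, compact (xsection F x) &
      convex_set (xsection F x : set R^o)].

Definition minimal_cusco F :=
  cusco F /\ forall G, cusco G -> G `<=` F -> G = F.

End Cusco.

Definition L0 (R : realType) (X : topologicalType) : set (set (X * R)) :=
  [set F | cusco F /\ forall x, isolated [set: X] x ->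
    exists y, xsection F x = [set y]].

Definition MC (R : realType) (X : topologicalType) : set (set (X * R)) :=
  [set F | minimal_cusco F].

Arguments L0 : clear implicits.
Arguments MC : clear implicits.

(* Main.v *)
Require Import Defs.
From mathcomp Require Import all_boot all_order all_algebra.
From mathcomp Require Import all_classical all_reals all_analysis.
Set Implicit Arguments.
Unset Strict Implicit.
Unset Printing Implicit Defensive.
Import Order.TTheory GRing.Theory Num.Theory.
Import numFieldNormedType.Exports.
Local Open Scope classical_set_scope.
Local Open Scope ring_scope.

(** Write [K] for a compact interval. A cusco map [F] has a countable base of
neighbourhoods among the open subsets of [X * R], and the sets of maps that
lie inside these neighbourhoods form a countable base at [F] for the upper
Vietoris topology ([first_countable_upper_vietoris]). The same argument serves
every space of cusco maps.

Two facts produce the neighbourhoods.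

- The complement of [F] is a countable union of open sets [B n], each inside
  a closed set [C n] that misses [F] ([usc_compl_bigcup]). A point [y] outside
  [F x] lies between two rationals [a] and [b] with [F x] disjoint from
  [[a, b]]. By upper semicontinuity the set of all such [x] is open for fixed
  [a] and [b], hence it is exhausted by countably many open sets whose closures
  stay inside it ([perfectly_normal_open]).
- [F] is bounded, and [X * K] inherits countable compactness from [X]. Both
  follow from [countably_compact_uniform].

Let [K] contain all values of [F] in its interior, and let [W n] be the strip
over the interior of [K] with [C 0, ..., C (n - 1)] removed. If an open [V]
contains [F], then [V] and the sets [B n] cover [X * K]. Finitely many of them
suffice, and then [W n] is contained in [V] for large [n]. *)

Section CountablyCompact.
Context {X : topologicalType} (X_ccompact : countably_compact [set: X]).

(** The interiors of the sets [P n] form an increasing open cover, so a single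
one of them is everything. In this form, passing from a local to a global [n]
gives both the boundedness of a cusco map and the tube lemma below. *)
Lemma countably_compact_uniform (P : nat -> set X) :
    {homo P : m n / (m <= n)%N >-> m `<=` n} ->
    (forall x : X, exists n, \forall x' \near x, P n x') ->
  exists n, forall x : X, P n x.
Proof.
move=> P_homo P_near.
have [|x _|D _ D_cover] := @X_ccompact setT (fun n => (P n)°).
- by move=> n _; exact: open_interior.
- by have [n Pn] := P_near x; exists n.
exists (\max_(i <- finmap.enum_fset D) i)%N => x.
have [i Di /interior_subset] := D_cover x I.
by apply: P_homo; exact: leq_bigmax_seq.
Qed.

(** Over one point the compactness of [K] selects a single [n], and by the tube
lemma the same [n] serves for all nearby points; the countable compactness of
[X] then makes [n] uniform. *)
Lemma countably_compact_tube {Y : topologicalType} (K : set Y)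
    (A : nat -> set (X * Y)) : compact K ->
    (forall n, open (A n)) -> {homo A : m n / (m <= n)%N >-> m `<=` n} ->
    setT `*` K `<=` \bigcup_n A n ->
  exists n, setT `*` K `<=` A n.
Proof.
move=> /compact_near_coveringP K_near A_open A_homo K_cover.
have [m n mn x Kx y Ky|x|n An] :=
  @countably_compact_uniform (fun n => [set x | forall y, K y -> A n (x, y)]).
- exact/(A_homo _ _ mn)/Kx.
  (* One use of compactness along [filter_prod (nbhs x) \oo] yields both the
     index and the tube around [x]. *)
- have [|[U N] /= [xU [n _ nN]] UN] := K_near _ (filter_prod (nbhs x) \oo)
    (fun p y => A p.2 (p.1, y)).
  + move=> y Ky; have [n _ Anxy] := K_cover (x, y) (conj I Ky).
    have /= [[U V] /= [xU yV] UV] : nbhs (x, y) (A n) by exact: open_nbhs_nbhs.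
    exists (V, U `*` [set m | (n <= m)%N]) => /=.
      split=> //; exists (U, [set m | (n <= m)%N]) => //=; split=> //.
      exact: nbhs_infty_ge.
    by move=> [y' [x' m]] /= [Vy' [Ux' nm]]; exact/(A_homo _ _ nm)/UV.
  + exists n; apply: filterS xU => x' Ux' y Ky.
    by apply: (UN (x', n)) => //=; split=> //; exact/nN/leqnn.
- by exists n => -[x y] [_ Ky]; exact: An.
Qed.

End CountablyCompact.

(** The complement of an open set [U] is an intersection of open sets [G k], so
[U] is the union of the closed sets [~` G k]. Normality puts an open set
between each of these and [U]. *)
Lemma perfectly_normal_open {X : topologicalType} (U : set X) :
    perfectly_normal_space X -> open U ->
  exists P : nat -> set X, [/\ forall k, open (P k),
    forall k, closure (P k) `<=` U & U `<=` \bigcup_k P k].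
Proof.
move=> [X_normal X_Gdelta] U_open.
have [G G_open UG] := X_Gdelta (~` U) (open_closedC U_open).
have /choice[P PP] k : exists P, [/\ open P, ~` G k `<=` P & closure P `<=` U].
  have [|B /set_nbhsP[P [P_open GP PB]] BU] :=
    X_normal (~` G k) (open_closedC (G_open k)) U.
    apply/set_nbhsP; exists U; split=> // x Gx; apply: contrapT => Ux.
    by apply: Gx; move: (Ux : (~` U) x); rewrite UG; exact.
  by exists P; split=> //; exact/(subset_trans _ BU)/closureS.
exists P; split=> [k|k|x Ux]; [by case: (PP k)..|].
apply: contrapT => Px; suff : (~` U) x by [].
rewrite UG => k _; apply: contrapT => Gx; apply: Px; exists k => //.
by have [_ GP _] := PP k; exact: GP.
Qed.

Section CountableCharacter.
Context {R : realType} {X : topologicalType}.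
Hypothesis X_pnormal : perfectly_normal_space X.

(** Boxes over rational intervals suffice: upper semicontinuity makes the set
of [x] with [xsection F x] disjoint from [[a, b]] open, and perfect normality
exhausts it from inside. Equivalently, the graph is a countable intersection of
open sets [~` C n] whose closures still intersect to the graph; the complement
is the form that a covering argument uses. *)
Lemma usc_compl_bigcup (F : set (X * R)) :
    usc F -> (forall x : X, closed (xsection F x)) ->
  exists B C : nat -> set (X * R), [/\ forall n, open (B n),
    forall n, closed (C n), forall n, B n `<=` C n,
    forall n, F `<=` ~` C n & ~` F `<=` \bigcup_n B n].
Proof.
move=> F_usc F_closed.
pose J (p : rat * rat) : set R := `[ratr p.1, ratr p.2]%classic.
pose U p := [set x | xsection F x `<=` ~` J p].
have U_open p : open (U p).
  rewrite openE => x Ux; apply: F_usc => //.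
  exact/closed_openC/interval_closed.
have /choice[P PP] p := @perfectly_normal_open X _ X_pnormal (U_open p).
(* The indices are triples of two rationals and one natural number, coded as a
   natural number; numbers that code nothing contribute the empty set. *)
pose B n : set (X * R) := if unpickle n is Some (p, k) then
  P p k `*` `]ratr p.1, ratr p.2[%classic else set0.
pose C n : set (X * R) := if unpickle n is Some (p, k) then
  closure (P p k) `*` J p else set0.
exists B, C; split.
- move=> n; rewrite /B; case: unpickle => [[p k]|]; last exact: open0.
  apply: openI; apply: open_comp; [by move=> ? _; exact: cvg_fst| |
    by move=> ? _; exact: cvg_snd|exact: interval_open].
  by case: (PP p).
- move=> n; rewrite /C; case: unpickle => [[p k]|]; last exact: closed0.
  apply: closedI; apply: closed_comp; [by move=> ? _; exact: cvg_fst|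
    exact: closed_closure|by move=> ? _; exact: cvg_snd|
    exact: interval_closed].
- move=> n; rewrite /B /C; case: unpickle => [[p k]|] //.
  by move=> [x y] [/subset_closure Px /subset_itv_oo_cc].
- move=> n [x y] Fxy; rewrite /C; case: unpickle => [[p k]|] // [/= Px Jy].
  have [_ /(_ _ _ Px) Ux _] := PP p.
  by apply: (Ux y) => //; exact/xsectionP.
- move=> [x y] Fxy.
  have : nbhs y (~` xsection F x).
    apply: open_nbhs_nbhs; split; first exact/closed_openC.
    by move/xsectionP.
  move=> /nbhs_ballP[e /= e_gt0 eF].
  have [|a] := @rat_in_itvoo R (y - e) y; first by rewrite gtrBl.
  rewrite in_itv /= => /andP[ya ay].
  have [|b] := @rat_in_itvoo R y (y + e); first by rewrite ltrDl.
  rewrite in_itv /= => /andP[yb be].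
  have Ux : U (a, b) x.
    move=> z Fxz; rewrite /J /= in_itv /= => /andP[az zb]; apply: eF Fxz.
    by rewrite /ball /= distrC ltr_distl (lt_le_trans ya)// (le_lt_trans zb).
  have [_ _ /(_ _ Ux)[k _ Px]] := PP (a, b).
  exists (pickle ((a, b), k)); first exact: I.
  by rewrite /B pickleK; split; rewrite //= in_itv /= ay.
Qed.

(** Cut down a bounded open strip around [F] by the closed sets of
[usc_compl_bigcup]; the tube lemma on the closed strip shows that finitely many
cuts bring it inside any given open set around [F]. *)
Lemma cusco_countable_character (F : set (X * R)) :
    countably_compact [set: X] -> cusco F ->
  exists W : nat -> set (X * R), [/\ forall n, open (W n),
    forall n, F `<=` W n &
    forall V, open V -> F `<=` V -> exists n, W n `<=` V].
Proof.
move=> X_ccompact [F_usc F_cusco].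
have [m Fm] : exists m : nat, forall x, xsection F x `<=` `]- m%:R, m%:R[.
  apply: (@countably_compact_uniform _ X_ccompact
    (fun m : nat => [set x | xsection F x `<=` `]- m%:R, m%:R[])).
    move=> m n mn x Fx; apply: (subset_trans Fx); apply: subset_itv.
    - by rewrite bnd_simp lerN2 ler_nat.
    - by rewrite bnd_simp ler_nat.
  move=> x; have [_ /compact_bounded/pinfty_ex_gt0[M M_gt0 FM] _] := F_cusco x.
  exists (Num.truncn M).+1.
  apply: F_usc => [|y Fxy]; first exact: interval_open.
  rewrite /= in_itv /= -ltr_norml.
  exact: le_lt_trans (FM _ Fxy) (truncnS_gt _).
have F_closed x : closed (xsection F x).
  by case: (F_cusco x) => _ /compact_closed + _; apply; exact: Rhausdorff.
have [B [C [B_open C_closed BC CF FB]]] := usc_compl_bigcup F_usc F_closed.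
pose W n := (setT `*` `]- m%:R, m%:R[%classic) `&` ~` \bigcup_(i in `I_n) C i.
exists W; split=> [n|n [x y] Fxy|V V_open FV].
- apply: openI.
    apply: openI; first exact: openT.
    by apply: open_comp (interval_open _ _) => // ? _; exact: cvg_snd.
  by apply/closed_openC/closed_bigcup.
- split; first by split=> //; apply: (Fm x); exact/xsectionP.
  by move=> [i _]; exact: CF.
(* The pieces [B i] cover what [V] misses, so finitely many of them complete
   [V] to a cover of the closed strip. *)
have [|||n Vn] := @countably_compact_tube _ X_ccompact R `[- m%:R, m%:R]
  (fun n => V `|` \bigcup_(i in `I_n) B i) (@segment_compact R _ _).
- by move=> n; apply: openU => //; exact: bigcup_open.
- move=> i j ij; apply: setUS; apply: bigcup_subset => k /= ki.
  exact: leq_trans ki ij.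
- move=> [x y] _; have [Vxy|Vxy] := pselect (V (x, y)).
    by exists 0%N => //; left.
  have [|n _ Bn] := FB (x, y); first by move/FV.
  by exists n.+1 => //; right; exists n => /=.
exists n => -[x y] [[_ /subset_itv_oo_cc xy] Cxy].
have [//|[i ni Bi]] := Vn (x, y) (conj I xy).
by case: Cxy; exists i => //; exact: BC.
Qed.

End CountableCharacter.

(** Basic neighbourhoods of the point [F] are the sets [upper_set V], and
[upper_set] is monotone, so a countable base around the set [F] in [T] is
enough. *)
Lemma first_countable_upper_vietoris {T : topologicalType} (S : set (set T)) :
    (forall F, S F -> exists W : nat -> set T, [/\ forall n, open (W n),
      forall n, F `<=` W n &
      forall V, open V -> F `<=` V -> exists n, W n `<=` V]) ->
  first_countable (upper_vietoris S).
Proof.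
move=> S_countable F.
have [W [W_open FW W_base]] := S_countable (set_val F) (set_valP F).
exists (range (fun n => @upper_set _ S (W n))); first exact: card_image_le.
split=> [_ [n _ <-]|N].
  apply: open_nbhs_nbhs; split; last exact: FW.
  exists [set W n]; last exact: bigcup_set1.
  by move=> _ ->; exact: W_open.
rewrite /= nbhsE => -[_ [[D D_open <-] [V DV FV]] VN].
have [n WV] := W_base V (D_open V DV) FV.
exists (@upper_set _ S (W n)); first by exists n.
by move=> G GW; apply: VN; exists V => //; exact: subset_trans WV.
Qed.

Theorem corollary5p3 (R : realType) (X : topologicalType)
  (X_nonempty : [set: X] !=set0) (X_hausdorff : hausdorff_space X)
  (X_ccompact : countably_compact [set: X])
  (X_pnormal : perfectly_normal_space X) :
  first_countable (upper_vietoris (L0 R X)) /\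
  first_countable (upper_vietoris (MC R X)).
Proof.
split; apply: first_countable_upper_vietoris => F.
- by move=> [F_cusco _]; exact: cusco_countable_character.
- by move=> [F_cusco _]; exact: cusco_countable_character.
Qed.
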